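(* Let $d\ge1$, $\alpha\in(0,2)$, $\beta\in(0,1)$, and let $\kappa:\mathbb R^d\times\mathbb R^d\to\mathbb R$ be measurable with $0<\kappa_0\le\kappa(x,z)\le\kappa_1$, $\kappa(x,z)=\kappa(x,-z)$ and $|\kappa(x,z)-\kappa(y,z)|\le\kappa_2|x-y|^\beta$ for all $x,y,z\in\mathbb R^d$. Let $u\in C_b([0,1]\times\mathbb R^d)$ with $$\lim_{t\downarrow0}\sup_{x\in\mathbb R^d}|u(t,x)-u(0,x)|=0.$$ Suppose that for each $x\in\mathbb R^d$ the map $t\mapsto\mathscr L^\kappa_\alpha u(t,x)$ is continuous on $(0,1]$, and that for some $\gamma\in((\alpha-1)\vee0,1)$ and any $\varepsilon\in(0,1)$ there is a constant $C_\varepsilon$ such that $$\sup_{t\in(\varepsilon,1)}|u(t,x)-u(t,x')|\le C_\varepsilon|x-x'|^\gamma\qquad\text{for all }x,x'\in\mathbb R^d.$$ If $u$ satisfies $\partial_tu(t,x)=\mathscr L^\kappa_\alpha u(t,x)$ for all $(t,x)\in(0,1)\times\mathbb R^d$, then for all $t\in(0,1)$, $$\sup_{x\in\mathbb R^d}u(t,x)\le\sup_{x\in\mathbb R^d}u(0,x).$$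
   Context: $\mathscr L^\kappa_\alpha f(x):=\mathrm{p.v.}\int_{\mathbb R^d}(f(x+z)-f(x))\frac{\kappa(x,z)}{|z|^{d+\alpha}}dz=\lim_{\varepsilon\to0}\int_{|z|>\varepsilon}(f(x+z)-f(x))\frac{\kappa(x,z)}{|z|^{d+\alpha}}dz$, and $\mathscr L^\kappa_\alpha u(t,x)$ means the operator applied to $u(t,\cdot)$ at $x$ (assumed to exist wherever it is mentioned). $C_b$ denotes bounded continuous functions; $a\vee b=\max\{a,b\}$. *)

(* Defs.v *)
From HB Require Import structures.
From mathcomp Require Import all_boot all_order all_algebra.
From mathcomp Require Import all_classical all_reals all_analysis.

Set Implicit Arguments.
Unset Strict Implicit.
Unset Printing Implicit Defensive.
Import Order.TTheory GRing.Theory Num.Theory.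
Import numFieldTopology.Exports numFieldNormedType.Exports.
Local Open Scope classical_set_scope.
Local Open Scope ring_scope.

(* Product sigma-algebra on row vectors, built as the library does for tuples;
   over the reals it is the Borel sigma-algebra of R^n. *)
Section measurable_row.
Context {d : measure_display} {T : sigmaRingType d}.
Variable n : nat.

Definition row_coord (i : 'I_n) (x : 'rV[T]_n) : T := x ord0 i.

Let row_set0 : g_sigma_preimage row_coord set0.
Proof. exact: sigma_algebra0. Qed.

Let row_setC A : g_sigma_preimage row_coord A ->
  g_sigma_preimage row_coord (~` A).
Proof. exact: sigma_algebraC. Qed.

Let row_bigcup (F : (set 'rV[T]_n)^nat) :
  (forall i, g_sigma_preimage row_coord (F i)) ->
  g_sigma_preimage row_coord (\bigcup_i (F i)).
Proof. exact: sigma_algebra_bigcup. Qed.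

HB.instance Definition _ := @isMeasurable.Build (measure_tuple_display d)
  'rV[T]_n (g_sigma_preimage row_coord) row_set0 row_setC row_bigcup.

End measurable_row.

Section lebesgue_row.
Variable R : realType.

Definition row_cons n (p : measurableTypeR R * 'rV[R]_n) : 'rV[R]_n.+1 :=
  row_mx (p.1%:M : 'rV[R]_1) p.2.

(* d-dimensional Lebesgue measure: the iterated product of the Lebesgue measure
   of R, transported to row vectors; on 'rV_0 it is the unit mass. *)
Fixpoint lebesgue_row (n : nat) : set 'rV[R]_n -> \bar R :=
  match n with
  | 0 => fun A => \d_(0 : 'rV[R]_0) A
  | n.+1 =>
    pushforward (@lebesgue_measure R \x @lebesgue_row n)%E (@row_cons n)
  end.

Lemma measurable_row_coord n (i : 'I_n) :
  measurable_fun [set: 'rV[R]_n] (row_coord i).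
Proof.
move=> _ Y mY; rewrite setTI; apply: sub_sigma_algebra => /=.
rewrite -bigcup_seq/=; exists i => /=; first by rewrite mem_index_enum.
by exists Y => //; rewrite setTI.
Qed.


Lemma measurable_fun_rowP (d : measure_display) (T : measurableType d) n
    (f : T -> 'rV[R]_n) :
  (forall i, measurable_fun [set: T] (fun x => f x ord0 i)) ->
  measurable_fun [set: T] f.
Proof.
move=> mf _ A mA; rewrite setTI.
suff : g_sigma_preimage (@row_coord _ R n) `<=` [set B | measurable (f @^-1` B)].
  exact.
apply: smallest_sub => /=.
  split => [|B mB|F mF] /=.
  - by rewrite preimage_set0.
  - by rewrite setTD -preimage_setC; exact: measurableC.
  - by rewrite preimage_bigcup; exact: bigcupT_measurable.
move=> B; rewrite -bigcup_seq/= => -[i _ [C mC <-]].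
by rewrite setTI -comp_preimage -[X in measurable X]setTI; exact: mf.
Qed.

Definition row_uncons n (x : 'rV[R]_n.+1) : measurableTypeR R * 'rV[R]_n :=
  (x ord0 ord0, \row_j x ord0 (lift ord0 j)).

Lemma row_cons0 n (p : measurableTypeR R * 'rV[R]_n) : row_cons p ord0 ord0 = p.1.
Proof.
rewrite /row_cons (_ : ord0 = lshift n ord0 :> 'I_(1 + n)); last exact/val_inj.
by rewrite (row_mxEl (p.1%:M : 'rV[R]_1)) mxE eqxx.
Qed.

Lemma row_consS n (p : measurableTypeR R * 'rV[R]_n) j :
  row_cons p ord0 (lift ord0 j) = p.2 ord0 j.
Proof.
rewrite /row_cons (_ : lift ord0 j = rshift 1 j :> 'I_(1 + n)); last first.
  exact/val_inj.
by rewrite (row_mxEr (p.1%:M : 'rV[R]_1)).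
Qed.

Lemma row_consK n : cancel (@row_cons n) (@row_uncons n).
Proof.
case=> x y; rewrite /row_uncons row_cons0; congr pair.
by apply/rowP => j; rewrite mxE row_consS.
Qed.

Lemma measurable_row_cons n : measurable_fun setT (@row_cons n).
Proof.
apply: measurable_fun_rowP => i.
have [->|[j ->]] : i = ord0 \/ exists j, i = lift ord0 j.
  by case: (unliftP ord0 i) => [j|] ->; [right; exists j|left].
  by under eq_fun do rewrite row_cons0; exact: measurable_fst.
under eq_fun do rewrite row_consS.
exact: (measurableT_comp (measurable_row_coord j) measurable_snd).
Qed.

Lemma measurable_row_uncons n : measurable_fun setT (@row_uncons n).
Proof.
apply/measurable_fun_pair; first exact: measurable_row_coord.
apply: measurable_fun_rowP => i; under eq_fun do rewrite mxE.
exact: measurable_row_coord.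
Qed.

Section lebesgue_rowS.
Local Open Scope ereal_scope.
Variables (n : nat) (mu : {sigma_finite_measure set 'rV[R]_n -> \bar R}).

Local Notation nu := (@lebesgue_measure R \x mu).
Let push := pushforward nu (@row_cons n).

Let preimage_measurable (A : set 'rV[R]_n.+1) :
  measurable A -> measurable (@row_cons n @^-1` A).
Proof.
by move=> mA; rewrite -[X in measurable X]setTI; exact: measurable_row_cons.
Qed.

Let push0 : push set0 = 0.
Proof. by rewrite /push /pushforward preimage_set0 measure0. Qed.

Let push_ge0 A : 0 <= push A.
Proof. by rewrite /push /pushforward; apply: measure_ge0. Qed.

Let push_sigma_additive : semi_sigma_additive push.
Proof.
move=> F mF tF mUF; rewrite /push /pushforward preimage_bigcup.
apply: measure_semi_sigma_additive.
- by move=> k; exact: preimage_measurable.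
- apply/trivIsetP => /= i j _ _ ij; rewrite -preimage_setI.
  by move/trivIsetP : tF => /(_ _ _ _ _ ij) ->//; rewrite preimage_set0.
- by rewrite -preimage_bigcup; exact: preimage_measurable.
Qed.

HB.instance Definition _ := isMeasure.Build _ _ _ push
  push0 push_ge0 push_sigma_additive.

Let push_sigma_finite : sigma_finite setT push.
Proof.
have /sigma_finiteP[F [TF ndF Foo]] := sigma_finiteT (@lebesgue_measure R).
have /sigma_finiteP[G [TG ndG Goo]] := sigma_finiteT mu.
have TFG : \bigcup_k (F k `*` G k) = [set: measurableTypeR R * 'rV[R]_n].
  rewrite -subTset => -[x y] _.
  have [k _ Fkx] : (\bigcup_k F k) x by rewrite -TF.
  have [l _ Gly] : (\bigcup_k G k) y by rewrite -TG.
  exists (maxn k l) => //; split.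
  - by move: x Fkx; exact/subsetPset/ndF/leq_maxl.
  - by move: y Gly; exact/subsetPset/ndG/leq_maxr.
exists (fun k => @row_uncons n @^-1` (F k `*` G k)).
  by rewrite -preimage_bigcup TFG preimage_setT.
move=> k; have [mF Fk] := Foo k; have [mG Gk] := Goo k; split.
  rewrite -[X in measurable X]setTI; apply: measurable_row_uncons => //.
  exact: measurableX.
rewrite /push /pushforward -comp_preimage.
rewrite (_ : _ \o _ = id); last by apply/funext => p /=; rewrite row_consK.
by rewrite preimage_id product_measure1E// lte_mul_pinfty// ge0_fin_numE.
Qed.

HB.instance Definition _ := Measure_isSigmaFinite.Build _ _ _ push
  push_sigma_finite.

Lemma lebesgue_rowS_sigma_finite_measure :
  exists mu' : {sigma_finite_measure set 'rV[R]_n.+1 -> \bar R}, push = mu'.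
Proof. by exists push. Qed.

End lebesgue_rowS.

Lemma lebesgue_row_sigma_finite_measure n :
  exists mu : {sigma_finite_measure set 'rV[R]_n -> \bar R},
    @lebesgue_row n = mu.
Proof.
elim: n => [|n [mu IH]]; first by exists (\d_(0 : 'rV[R]_0)).
by rewrite /= IH; exact: lebesgue_rowS_sigma_finite_measure.
Qed.

Let lebesgue_row0 n : @lebesgue_row n set0 = 0%E.
Proof. by have [mu ->] := lebesgue_row_sigma_finite_measure n. Qed.

Let lebesgue_row_ge0 n A : (0 <= @lebesgue_row n A)%E.
Proof. by have [mu ->] := lebesgue_row_sigma_finite_measure n. Qed.

Let lebesgue_row_sigma_additive n : semi_sigma_additive (@lebesgue_row n).
Proof.
have [mu ->] := lebesgue_row_sigma_finite_measure n.
exact: measure_semi_sigma_additive.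
Qed.

HB.instance Definition _ n := isMeasure.Build _ _ _ (@lebesgue_row n)
  (lebesgue_row0 n) (@lebesgue_row_ge0 n) (@lebesgue_row_sigma_additive n).

Let lebesgue_row_sigma_finite n : sigma_finite setT (@lebesgue_row n).
Proof.
by have [mu ->] := lebesgue_row_sigma_finite_measure n; exact: sigma_finiteT.
Qed.

HB.instance Definition _ n := Measure_isSigmaFinite.Build _ _ _
  (@lebesgue_row n) (lebesgue_row_sigma_finite n).

Lemma lebesgue_row_box n (a b : 'rV[R]_n) :
  (forall i, a ord0 i <= b ord0 i) ->
  lebesgue_row [set x : 'rV[R]_n | forall i, a ord0 i <= x ord0 i <= b ord0 i]
  = (\prod_(i < n) (b ord0 i - a ord0 i))%:E.
Proof.
elim: n a b => [|n IH] a b ab.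
  rewrite big_ord0 /= diracE mem_set//=.
  by case.
rewrite big_ord_recl EFinM /= /pushforward.
pose a' := (row_uncons a).2; pose b' := (row_uncons b).2.
rewrite [X in (_ \x _)%E X](_ : _ = `[a ord0 ord0, b ord0 ord0] `*`
  [set x : 'rV[R]_n | forall i, a' ord0 i <= x ord0 i <= b' ord0 i]); last first.
  apply/seteqP; split=> p /=.
    move=> H; split=> [|i]; first by have := H ord0; rewrite row_cons0 in_itv.
    by have := H (lift ord0 i); rewrite row_consS !mxE.
  rewrite in_itv/= => -[H0 HS] i; case: (unliftP ord0 i) => [j|] ->.
    by have := HS j; rewrite row_consS !mxE.
  by rewrite row_cons0.
rewrite product_measure1E//=; last first.
  rewrite [X in measurable X](_ : _ = \bigcap_(i in [set: 'I_n])
      (row_coord i @^-1` `[a' ord0 i, b' ord0 i])); last first.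
    apply/seteqP; split=> x /= H i; first by move=> _ /=; rewrite in_itv/=; exact: H.
    by have := H i I; rewrite /= in_itv.
  apply: fin_bigcap_measurable => // i _.
  by rewrite -[X in measurable X]setTI; exact: measurable_row_coord.
rewrite IH; last by move=> i; rewrite !mxE.
congr (_ * _)%E.
  rewrite lebesgue_measure_itv/= lte_fin; case: ifPn => [_|]; first exact: EFinB.
  by rewrite -leNgt => ba; rewrite (@le_anti _ _ (a ord0 ord0) (b ord0 ord0)) ?subrr// ab.
by congr EFin; apply: eq_bigr => i _; rewrite !mxE.
Qed.

End lebesgue_row.

Section nonlocal_operator.
Variables (R : realType) (d : nat).
Implicit Types (x z : 'rV[R]_d) (f : 'rV[R]_d -> R).

(* Euclidean norm; the library norm on row vectors is the sup norm. *)
Definition enorm x : R := Num.sqrt (\sum_(i < d) x ord0 i ^+ 2).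

Variables (kappa : 'rV[R]_d -> 'rV[R]_d -> R) (alpha : R).

Definition truncated_nonlocal_op f x (eps : R) : R :=
  \int[@lebesgue_row R d]_(z in [set z | eps < enorm z])
    ((f (x + z) - f x) * (kappa x z / enorm z `^ (d%:R + alpha))).

Definition nonlocal_op_exists f x : Prop :=
  cvg (truncated_nonlocal_op f x eps @[eps --> 0^'+]).

Definition nonlocal_op f x : R :=
  lim (truncated_nonlocal_op f x eps @[eps --> 0^'+]).

End nonlocal_operator.

Definition bounded_continuous_on {T : topologicalType} {R : realType}
    (A : set T) (f : T -> R) : Prop :=
  {within A, continuous f} /\ [bounded f x | x in A].

(* Main.v *)
(** The equation holds pointwise, so the classical maximum principle applies once
    maxima are forced to exist.  For [r >= 1] let
    [phi x = |x - x0|^2 / (r^2 + |x - x0|^2)].  By the parallelogram law and the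
    convexity of [1/y], its second differences satisfy
    [phi (x + z) + phi (x - z) - 2 phi x <= 2 |z|^2 / (r^2 + |z|^2)
       <= 2 r^(-alpha/2) min (|z|^2, |z|^(alpha/2))],
    so the symmetry of [kappa] bounds all truncated operators of [phi] by
    [kappa1 r^(-alpha/2) G] with [G] finite and independent of [r] and [x].
    If [u t0 x0 > sup u(0, .)], then for a small [delta] and a large [K]
    independent of [r] the function [u t x - delta t - K phi x] attains its
    maximum over [0 <= t <= t0] at some [(ts, xs)] with [ts > 0].  There
    [delta <= d_t u = L u <= K kappa1 r^(-alpha/2) G], which fails for large [r]. *)

Require Import Defs.
From HB Require Import structures.
From mathcomp Require Import all_boot all_order all_algebra.
From mathcomp Require Import ring lra.
From mathcomp Require Import all_classical all_reals all_analysis.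
From mathcomp Require Import measurable_realfun.

Set Implicit Arguments.
Unset Strict Implicit.
Unset Printing Implicit Defensive.
Import Order.TTheory GRing.Theory Num.Theory.
Import numFieldTopology.Exports numFieldNormedType.Exports.
Local Open Scope classical_set_scope.
Local Open Scope ring_scope.

(** * Invariance of Lebesgue measure and integrals under [z -> -z] *)

Lemma eq_integral_pushforward (d d' : measure_display)
    (T : measurableType d) (T' : measurableType d')
    (R : realType) (mu : {measure set T -> \bar R})
    (nu : {measure set T' -> \bar R}) (phi : T -> T') (D : set T')
    (f : T' -> \bar R) :
  measurable_fun setT phi ->
  (forall C, measurable C -> mu (phi @^-1` C) = nu C) ->
  (\int[pushforward mu phi]_(x in D) f x = \int[nu]_(x in D) f x)%E.
Proof.
(* The canonical measure on [pushforward] is now the one on row vectors, so the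
   library instance has to be named. *)
move=> mphi munu; pose m : {measure set T' -> \bar R} :=
  measure_function_pushforward__canonical__measure_function_Measure mu mphi.
apply: (@eq_measure_integral _ _ _ _ nu m) => C mC _; exact: munu.
Qed.

Lemma measurable_row_opp (R : realType) n :
  measurable_fun [set: 'rV[R]_n] (-%R : 'rV[R]_n -> 'rV[R]_n).
Proof.
apply: measurable_fun_rowP => i; under eq_fun do rewrite mxE.
exact: (measurableT_comp (@oppr_measurable R setT) (measurable_row_coord i)).
Qed.

Lemma row_consN (R : realType) n (p : measurableTypeR R * 'rV[R]_n) :
  - row_cons p = row_cons (- p.1, - p.2).
Proof.
apply/rowP => i; rewrite mxE; case: (unliftP ord0 i) => [j|] ->.
  by rewrite !row_consS mxE.
by rewrite !row_cons0.
Qed.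

(** Induction on the dimension: the section of the reflected set at [x] is the reflection of the
    section at [-x]. The induction hypothesis handles the remaining coordinates, and reflection
    invariance on the line handles the first. *)
Lemma lebesgue_rowN (R : realType) n (A : set 'rV[R]_n) :
  measurable A -> lebesgue_row (-%R @^-1` A) = lebesgue_row A.
Proof.
elim: n A => [|n IH] A mA.
  congr lebesgue_row; apply/funext => x.
  by rewrite /preimage/= (thinmx0 (- x)) (thinmx0 x).
rewrite /= /pushforward /product_measure1.
set B := row_cons (n:=n) @^-1` A.
have mB : measurable B.
  by rewrite -[X in measurable X]setTI; exact: measurable_row_cons.
have mf : measurable_fun setT (@lebesgue_row R n \o xsection B).
  exact: measurable_fun_xsection.
pose N : measurableTypeR R -> measurableTypeR R := -%R.
(* The full domain is displayed as a preimage under [N] so that the change of variables formula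
   applies. *)
transitivity (\int[@lebesgue_measure R]_(x in N @^-1` setT)
    ((@lebesgue_row R n \o xsection B) \o N) x)%E.
  rewrite preimage_setT; apply: eq_integral => x _ /=.
  rewrite -[in RHS]IH; last exact: measurable_xsection.
  by congr lebesgue_row; apply/seteqP; split => y;
    rewrite /xsection/= !inE/= row_consN.
rewrite -ge0_integral_pushforward//; last exact: (@oppr_measurable R setT).
apply: eq_integral_pushforward; first exact: (@oppr_measurable R setT).
by move=> C mC; exact: (@lebesgue_measureN R C mC).
Qed.

Lemma integral_rowN (R : realType) n (D : set 'rV[R]_n) (f : 'rV[R]_n -> \bar R) :
  measurable D -> -%R @^-1` D = D -> measurable_fun setT f ->
  (@lebesgue_row R n).-integrable D (f \o -%R) ->
  (\int[@lebesgue_row R n]_(z in D) f (- z)%R =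
   \int[@lebesgue_row R n]_(z in D) f z)%E.
Proof.
move=> mD symD mf intf.
rewrite -[in LHS]symD -integral_pushforward//; last 2 first.
- exact: measurable_row_opp.
- by rewrite symD.
apply: eq_integral_pushforward; first exact: measurable_row_opp.
exact: lebesgue_rowN.
Qed.

Lemma Rintegral_rowN (R : realType) n (D : set 'rV[R]_n) (f : 'rV[R]_n -> R) :
  measurable D -> -%R @^-1` D = D -> measurable_fun setT f ->
  (@lebesgue_row R n).-integrable D (EFin \o (f \o -%R)) ->
  \int[@lebesgue_row R n]_(z in D) f (- z) =
  \int[@lebesgue_row R n]_(z in D) f z.
Proof.
move=> mD symD mf intf; congr fine.
by apply: (@integral_rowN R n D (EFin \o f)) => //; apply/measurable_EFinP.
Qed.

(** * Euclidean norm and cubes *)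

Section euclidean_norm.
Variables (R : realType) (d : nat).
Implicit Types x y z : 'rV[R]_d.

Lemma enorm_ge0 x : 0 <= enorm x.
Proof. exact: sqrtr_ge0. Qed.

Lemma sqr_enorm x : enorm x ^+ 2 = \sum_(i < d) x ord0 i ^+ 2.
Proof. by rewrite sqr_sqrtr// sumr_ge0// => i _; rewrite sqr_ge0. Qed.

Lemma enormN x : enorm (- x) = enorm x.
Proof. by congr Num.sqrt; apply: eq_bigr => i _; rewrite mxE sqrrN. Qed.

Lemma enorm0 : enorm (0 : 'rV[R]_d) = 0.
Proof. by rewrite /enorm big1 ?sqrtr0// => i _; rewrite mxE expr0n. Qed.

Lemma coord_le_enorm x i : `|x ord0 i| <= enorm x.
Proof.
rewrite -(@ler_pXn2r _ 2) ?nnegrE ?normr_ge0 ?enorm_ge0//.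
rewrite real_normK ?num_real// sqr_enorm (bigD1 i)//= lerDl sumr_ge0// => j _.
by rewrite sqr_ge0.
Qed.

Lemma enorm_parallelogram x y :
  enorm (x + y) ^+ 2 + enorm (x - y) ^+ 2 = 2 * (enorm x ^+ 2 + enorm y ^+ 2).
Proof.
rewrite !sqr_enorm -!big_split/= mulr_sumr; apply: eq_bigr => i _.
by rewrite !mxE; ring.
Qed.

Lemma measurable_sqr_enorm :
  measurable_fun [set: 'rV[R]_d] (fun x => enorm x ^+ 2).
Proof.
under eq_fun do rewrite sqr_enorm.
apply: measurable_sum => i.
by apply: measurable_funX; exact: measurable_row_coord.
Qed.

Lemma measurable_enorm : measurable_fun [set: 'rV[R]_d] (@enorm R d).
Proof.
rewrite (_ : @enorm R d = Num.sqrt \o (fun x => enorm x ^+ 2)); last first.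
  by apply/funext => x /=; rewrite sqrtr_sqr ger0_norm// enorm_ge0.
apply: measurableT_comp measurable_sqr_enorm.
exact: (continuous_measurable_fun (@sqrt_continuous R)).
Qed.

Lemma measurable_enorm_gt eps : measurable [set z : 'rV[R]_d | eps < enorm z].
Proof.
rewrite (_ : [set _ | _] = setT `&` @enorm R d @^-1` `]eps, +oo[).
  by apply: measurable_enorm.
by apply/seteqP; split=> z /=; rewrite in_itv/= andbT => // -[].
Qed.

(** The bounds are entries of constant row vectors, to match the form of [lebesgue_row_box]. *)
Definition box (r : R) : set 'rV[R]_d := 
  [set x | forall i, (const_mx (- r) : 'rV[R]_d) ord0 i <= x ord0 i
                       <= (const_mx r : 'rV[R]_d) ord0 i].

Lemma measurable_box r : measurable (box r).
Proof.
rewrite [X in measurable X](_ : _ = \bigcap_(i in [set: 'I_d])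
    (row_coord i @^-1` `[- r, r])); last first.
  apply/seteqP; split=> x /= H i.
    by move=> _ /=; rewrite in_itv/=; have := H i; rewrite !mxE.
  by have := H i I; rewrite /= in_itv/= !mxE.
apply: fin_bigcap_measurable => // i _.
by rewrite -[X in measurable X]setTI; exact: measurable_row_coord.
Qed.

Lemma lebesgue_row_cube r : 0 <= r -> lebesgue_row (box r) = ((2 * r) ^+ d)%:E.
Proof.
move=> r0; rewrite lebesgue_row_box; last by move=> i; rewrite !mxE; lra.
congr EFin; rewrite (eq_bigr (fun=> 2 * r)); last by move=> i _; rewrite !mxE; ring.
by rewrite prodr_const card_ord.
Qed.

Lemma enorm_box z r : enorm z <= r -> box r z.
Proof.
by move=> zr i; rewrite !mxE -ler_norml (le_trans (coord_le_enorm _ _)).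
Qed.

End euclidean_norm.

(** * Integrability of the weight by dyadic annuli *)

(** The left-hand side bounds [|z|^p / |z|^(d + alpha)] on the annulus [r < |z| <= 2 r], times the
    volume of the cube of half-side [2 r]. The volume cancels [r^d], so along geometric radii these
    terms form a geometric series. *)
Lemma powR_annulus (R : realType) (d : nat) (alpha p r : R) : 0 < r ->
  (2 * r) `^ p / r `^ (d%:R + alpha) * (2 * (2 * r)) ^+ d =
  2 `^ p * 4 ^+ d * r `^ (p - alpha).
Proof.
move=> r0; have rn0 : r != 0 by rewrite gt_eqF.
rewrite powRM ?ltW// [r `^ (p - _)]powRB ?rn0 ?implybT//.
rewrite [r `^ (_ + _)]powRD ?rn0 ?implybT//.
rewrite powR_mulrn ?ltW// mulrA exprMn (_ : 2 * 2 = 4); last by ring.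
by field; rewrite expf_neq0//= gt_eqF// powR_gt0.
Qed.

Lemma powR_geometric (R : realType) (c theta e : R) (k : nat) :
  0 < c -> 0 < theta -> (c * theta ^+ k) `^ e = c `^ e * (theta `^ e) ^+ k.
Proof.
move=> c0 t0; rewrite powRM ?ltW ?exprn_gt0//; congr (_ * _).
by rewrite -(powR_mulrn k (ltW t0)) -(powR_mulrn k (powR_ge0 _ _)) -!powRrM mulrC.
Qed.

Lemma nneseries_geometric_lty (R : realType) (a z : R) :
  0 <= a -> 0 < z < 1 -> (\sum_(k <oo) (a * z ^+ k)%:E < +oo)%E.
Proof.
move=> a0 /andP[z0 z1]; apply: (@le_lt_trans _ _ (a / (1 - z))%:E); last exact: ltry.
apply: lime_le.
  by apply: is_cvg_nneseries => n _ _; rewrite lee_fin mulr_ge0// exprn_ge0// ltW.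
apply: nearW => n; rewrite sumEFin lee_fin.
by apply: geometric_le_lim => //; rewrite ger0_norm ?ltW.
Qed.

(* The majorant is the series of the suprema over the annuli times the
   indicators of cubes containing them. *)
Lemma annuli_majorant (R : realType) (d : nat) (alpha p c theta : R) :
  0 < alpha -> 0 <= p -> 0 < c -> 0 < theta -> theta `^ (p - alpha) < 1 ->
  exists h : 'rV[R]_d -> \bar R,
    [/\ measurable_fun setT h, forall z, (0 <= h z)%E,
        (\int[@lebesgue_row R d]_z h z < +oo)%E &
        forall k z, c * theta ^+ k < enorm z <= 2 * (c * theta ^+ k) ->
          ((enorm z `^ p / enorm z `^ (d%:R + alpha))%:E <= h z)%E].
Proof.
move=> a0 p0 c0 t0 t1; pose r k := c * theta ^+ k.
have r0 k : 0 < r k by rewrite mulr_gt0// exprn_gt0.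
pose m k := (2 * r k) `^ p / r k `^ (d%:R + alpha).
have m0 k : 0 <= m k by rewrite mulr_ge0// ?powR_ge0// invr_ge0 powR_ge0.
pose h k (z : 'rV[R]_d) := ((m k)%:E * (\1_(box (2 * r k)) z)%:E)%E.
have h0 k z : (0 <= h k z)%E.
  by rewrite mule_ge0// lee_fin.
have mI k : measurable_fun setT (fun z : 'rV[R]_d => (\1_(box (2 * r k)) z : R)%:E).
  by apply/measurable_EFinP; apply: measurable_indic; exact: measurable_box.
have mh k : measurable_fun setT (h k) by exact: measurable_funeM.
exists (fun z => \sum_(k <oo) h k z)%E; split.
- exact: ge0_emeasurable_sum.
- by move=> z; apply: nneseries_ge0.
- rewrite integral_nneseries//.
  rewrite (eq_eseriesr (g := fun k => ((2 `^ p * 4 ^+ d * c `^ (p - alpha)) *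
      (theta `^ (p - alpha)) ^+ k)%:E)); last first.
    move=> k _; rewrite /h ge0_integralZl ?lee_fin//.
    rewrite integral_indic//; last exact: measurable_box.
    rewrite setIT /= lebesgue_row_cube; last by rewrite mulr_ge0// ltW.
    by rewrite -EFinM /m powR_annulus// powR_geometric// mulrA.
  apply: nneseries_geometric_lty; last by rewrite powR_gt0.
  by rewrite !mulr_ge0// ?powR_ge0// exprn_ge0.
- move=> k z /andP[rz zr].
  have z0 : 0 < enorm z by rewrite (lt_trans (r0 k)).
  have rk0 : 0 <= r k by exact: ltW.
  apply: (@le_trans _ _ (h k z)); last first.
    by rewrite (nneseriesD1 (n := k))// leeDl// nneseries_ge0.
  rewrite /h indicE mem_set ?mule1; last exact: enorm_box.
  rewrite lee_fin; apply: ler_pM; rewrite ?powR_ge0// ?invr_ge0 ?powR_ge0//.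
    by apply: ge0_ler_powR => //; rewrite nnegrE ?enorm_ge0// mulr_ge0.
  rewrite lef_pV2 ?posrE ?powR_gt0//.
  by apply: ge0_ler_powR; rewrite ?nnegrE ?enorm_ge0 ?(ltW rz)// addr_ge0// ltW.
Qed.

(** The least [k] with [t <= 2^(k+1)] works: minimality gives the strict lower bound, and [1 < t]
    gives it for [k = 0]. *)
Lemma exists_dyadic_gt1 (R : realType) (t : R) :
  1 < t -> exists k : nat, 2 ^+ k < t <= 2 * 2 ^+ k.
Proof.
move=> t1; have ex : exists k : nat, t <= 2 * 2 ^+ k.
  exists (Num.trunc t).+1; apply: (le_trans (ltW (truncnS_gt t))).
  rewrite -exprS -natrX ler_nat (leq_trans (leqnSn _))//.
  by rewrite ltnW// ltn_expl.
exists (ex_minn ex); case: ex_minnP => -[|k] tk mink; first by rewrite expr0 t1.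
rewrite tk andbT exprS ltNge; apply/negP => /mink; by rewrite ltnn.
Qed.

(** Here [k] is least with [1/t < 2^(k+1)]; minimality gives the upper bound [t <= 2^(-k)], and
    [t <= 1] gives it for [k = 0]. *)
Lemma exists_dyadic_le1 (R : realType) (t : R) :
  0 < t <= 1 -> exists k : nat, 2^-1 * 2^-1 ^+ k < t <= 2 * (2^-1 * 2^-1 ^+ k).
Proof.
move=> /andP[t0 t1]; have ex : exists k : nat, t^-1 < 2 * 2 ^+ k.
  exists (Num.trunc t^-1).+1; apply: (lt_le_trans (truncnS_gt t^-1)).
  rewrite -exprS -natrX ler_nat (leq_trans (leqnSn _))//.
  by rewrite ltnW// ltn_expl.
exists (ex_minn ex); case: ex_minnP => k tk mink.
rewrite mulrA divff// mul1r exprVn -invfM.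
rewrite invf_plt ?posrE ?mulr_gt0 ?exprn_gt0// tk/=.
case: k tk mink => [|k] tk mink; first by rewrite expr0 invr1.
rewrite -[t]invrK lef_pV2 ?posrE ?invr_gt0 ?exprn_gt0//.
by rewrite exprS leNgt; apply/negP => /mink; rewrite ltnn.
Qed.

(** The square tames the singularity at the origin because [alpha < 2]. The exponent [alpha / 2] is
    below [alpha], giving integrability at infinity, yet positive, giving the barrier estimate a
    negative power of its scale. *)
Definition levy_weight (R : realType) (d : nat) (alpha : R) (z : 'rV[R]_d) : R :=
  Num.min (enorm z ^+ 2) (enorm z `^ (alpha / 2)) / enorm z `^ (d%:R + alpha).

Lemma levy_weight_ge0 (R : realType) (d : nat) (alpha : R) (z : 'rV[R]_d) :
  0 <= levy_weight alpha z.
Proof. by rewrite divr_ge0 ?powR_ge0// le_min powR_ge0 sqr_ge0. Qed.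

Lemma measurable_inv_enorm_powR (R : realType) (d : nat) (e : R) :
  measurable_fun [set: 'rV[R]_d] (fun z => (enorm z `^ e)^-1).
Proof.
under eq_fun do rewrite -powRN.
exact: (measurableT_comp (measurable_powR _) (@measurable_enorm R d)).
Qed.

Lemma measurable_levy_weight (R : realType) (d : nat) (alpha : R) :
  measurable_fun [set: 'rV[R]_d] (@levy_weight R d alpha).
Proof.
apply: measurable_funM; last exact: measurable_inv_enorm_powR.
apply: measurable_minr; first exact: measurable_sqr_enorm.
exact: (measurableT_comp (measurable_powR _) (@measurable_enorm R d)).
Qed.

(** Annuli of inner radius [2^(-k-1)] with [p = 2] cover [0 < |z| <= 1], and those of inner radius
    [2^k] with [p = alpha / 2] cover [|z| > 1]. The series have ratios [2^(alpha - 2)] and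
    [2^(-alpha / 2)], both below 1. *)
Lemma levy_weight_integral_lty (R : realType) (d : nat) (alpha : R) :
  0 < alpha < 2 ->
  (\int[@lebesgue_row R d]_(z in [set z | (0 < enorm z)%R])
    (levy_weight alpha z)%:E < +oo)%E.
Proof.
move=> /andP[a0 a2].
have two_powR_gt1 (e : R) : 0 < e -> 1 < 2 `^ e.
  move=> e0; suff : ln 1 < ln (2 `^ e) by rewrite ltr_ln ?posrE ?powR_gt0.
  by rewrite ln1 ln_powR mulr_gt0// ln_gt0// ltr1n.
have ratio1 : 2^-1 `^ (2 - alpha) < 1 :> R.
  rewrite -powR_inv1// -powRrM mulN1r powRN invf_lt1 ?powR_gt0//.
  by rewrite two_powR_gt1// subr_gt0.
have ratio2 : 2 `^ (alpha / 2 - alpha) < 1 :> R.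
  rewrite (_ : alpha / 2 - alpha = - (alpha / 2)); last by field.
  by rewrite powRN invf_lt1 ?powR_gt0// two_powR_gt1// divr_gt0.
have half0 : 0 < 2^-1 :> R by rewrite invr_gt0.
have [h1 [mh1 h10 oo1 b1]] :=
  @annuli_majorant R d alpha 2 2^-1 2^-1 a0 (ler0n _ 2) half0 half0 ratio1.
have s0 : 0 <= alpha / 2 by rewrite divr_ge0// ltW.
have [h2 [mh2 h20 oo2 b2]] :=
  @annuli_majorant R d alpha (alpha / 2) 1 2 a0 s0 ltr01 (ltr0n _ 2) ratio2.
have mD := @measurable_enorm_gt R d 0.
apply: (@le_lt_trans _ _
  (\int[@lebesgue_row R d]_(z in [set z | (0 < enorm z)%R]) (h1 z + h2 z))%E).
  apply: ge0_le_integral => //.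
  - by move=> z _; rewrite lee_fin levy_weight_ge0.
  - apply/measurable_EFinP; by apply: measurable_funTS; exact: measurable_levy_weight.
  - by apply: measurable_funTS; apply: emeasurable_funD.
  move=> z /= z0; have [z1|z1] := leP (enorm z) 1.
    have [k kz] : exists k : nat, 2^-1 * 2^-1 ^+ k < enorm z <= 2 * (2^-1 * 2^-1 ^+ k).
      by apply: exists_dyadic_le1; rewrite z0 z1.
    apply: le_trans (leeDl _ (h20 z)); apply: le_trans (b1 k z kz).
    rewrite lee_fin ler_wpM2r ?invr_ge0 ?powR_ge0// powR_mulrn ?enorm_ge0//.
    by rewrite ge_min lexx.
  have [k kz] := exists_dyadic_gt1 z1.
  apply: le_trans (leeDr _ (h10 z)); apply: le_trans (b2 k z _); last by rewrite mul1r.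
  by rewrite lee_fin ler_wpM2r ?invr_ge0 ?powR_ge0// ge_min lexx orbT.
rewrite ge0_integralD//; [|by apply: measurable_funTS|by apply: measurable_funTS].
by rewrite lte_add_pinfty//; [apply: le_lt_trans oo1|apply: le_lt_trans oo2];
  apply: ge0_subset_integral.
Qed.

(** * Comparison of real-valued integrals under domination *)

(* No measurability is needed since the integral of a nonnegative function is
   defined as a supremum over the simple functions below it. *)
Lemma ge0_le_integral_pointwise (d : measure_display) (T : measurableType d)
    (R : realType) (mu : {measure set T -> \bar R}) (D : set T)
    (f g : T -> \bar R) :
  (forall x, D x -> 0 <= f x)%E -> (forall x, D x -> f x <= g x)%E ->
  (\int[mu]_(x in D) f x <= \int[mu]_(x in D) g x)%E.
Proof.
move=> f0 fg; have g0 x : D x -> (0 <= g x)%E.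
  by move=> Dx; rewrite (le_trans (f0 x Dx)) ?fg.
rewrite !ge0_integralE//; apply: ereal_sup_le => _ [h hf <-]; exists h => // x.
apply: le_trans (hf x) _; rewrite /patch; case: ifPn => // /set_mem; exact: fg.
Qed.

(** Positive and negative parts are compared separately by pointwise monotonicity. The majorant [h]
    keeps both parts of [f] finite, so the inequality survives the passage to real values by
    [fine]. *)
Lemma le_Rintegral_dominated (d : measure_display) (T : measurableType d)
    (R : realType) (mu : {measure set T -> \bar R}) (D : set T) (f g h : T -> R) :
  measurable D -> mu.-integrable D (EFin \o g) -> mu.-integrable D (EFin \o h) ->
  (forall x, D x -> `|f x| <= h x) -> (forall x, D x -> f x <= g x) ->
  \int[mu]_(x in D) f x <= \int[mu]_(x in D) g x.
Proof.
move=> mD ig ih fh fg.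
pose F : T -> \bar R := EFin \o f; pose G : T -> \bar R := EFin \o g.
have ihoo : (\int[mu]_(x in D) (EFin \o h) x < +oo)%E.
  by rewrite (integrable_lty mD ih).
have posoo : (\int[mu]_(x in D) F^\+ x < +oo)%E.
  apply: le_lt_trans ihoo; apply: ge0_le_integral_pointwise => // x Dx.
  rewrite !funeposE/= ge_max !lee_fin.
  by rewrite !(le_trans _ (fh x Dx))// ler_norm.
have negoo : (\int[mu]_(x in D) F^\- x < +oo)%E.
  apply: le_lt_trans ihoo; apply: ge0_le_integral_pointwise => // x Dx.
  rewrite !funenegE/= ge_max !lee_fin.
  by rewrite !(le_trans _ (fh x Dx))// -normrN ler_norm.
have posfin : (\int[mu]_(x in D) F^\+ x)%E \is a fin_num.
  by rewrite ge0_fin_numE// integral_ge0.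
have negfin : (\int[mu]_(x in D) F^\- x)%E \is a fin_num.
  by rewrite ge0_fin_numE// integral_ge0.
apply: fine_le.
- by rewrite integralE fin_numB posfin negfin.
- exact: integrable_fin_num.
rewrite integralE [leRHS]integralE; apply: leeB.
- apply: ge0_le_integral_pointwise => // x Dx.
  by rewrite !funeposE/= ge_max !le_max !lee_fin fg// lexx orbT.
- apply: ge0_le_integral_pointwise => // x Dx.
  by rewrite !funenegE/= ge_max !le_max !lee_fin lerN2 fg// lexx orbT.
Qed.

Lemma integrable_EFinD (d : measure_display) (T : measurableType d) (R : realType)
    (mu : {measure set T -> \bar R}) (D : set T) (f g : T -> R) :
  measurable D -> mu.-integrable D (EFin \o f) -> mu.-integrable D (EFin \o g) ->
  mu.-integrable D (EFin \o (fun x => f x + g x)).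
Proof. by move=> mD intf intg; exact: (integrableD mD intf intg). Qed.

Lemma integrable_EFinZl (d : measure_display) (T : measurableType d) (R : realType)
    (mu : {measure set T -> \bar R}) (D : set T) (c : R) (f : T -> R) :
  measurable D -> mu.-integrable D (EFin \o f) ->
  mu.-integrable D (EFin \o (fun x => c * f x)).
Proof. by move=> mD intf; exact: (integrableZl mD c intf). Qed.

(** * The barrier and its second differences *)

Section barrier.
Variables (R : realType) (d : nat).
Implicit Types x z : 'rV[R]_d.

Definition barrier (r : R) (x0 x : 'rV[R]_d) : R :=
  enorm (x - x0) ^+ 2 / (r ^+ 2 + enorm (x - x0) ^+ 2).

Lemma barrier_ge0 r x0 x : 0 <= barrier r x0 x.
Proof. by rewrite divr_ge0// ?addr_ge0// sqr_ge0. Qed.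

Lemma barrier_le1 r x0 x : 0 < r -> barrier r x0 x <= 1.
Proof.
move=> r0; have y0 := sqr_ge0 (enorm (x - x0)).
have r20 : 0 < r ^+ 2 by rewrite exprn_gt0.
by rewrite ler_pdivrMr ?mul1r; lra.
Qed.

Lemma barrier_center r x0 : barrier r x0 x0 = 0.
Proof. by rewrite /barrier subrr enorm0 expr0n mul0r. Qed.

Lemma barrier_far r x0 x : 0 < r -> r <= enorm (x - x0) -> 2^-1 <= barrier r x0 x.
Proof.
move=> r0 rx; have : r ^+ 2 <= enorm (x - x0) ^+ 2.
  by rewrite ler_pXn2r ?nnegrE ?enorm_ge0// ltW.
have r20 : 0 < r ^+ 2 by rewrite exprn_gt0.
by move=> h; rewrite ler_pdivlMr; lra.
Qed.

(** With [c / (rho + c) = 1 - rho / (rho + c)], [harmonic] is the convexity of the inverse at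
    [rho + y + t], the midpoint of [rho + a] and [rho + b]. Then [gap] pays for replacing [y + t] by
    [y], using [rho / (rho + y) <= 1]. *)
Let second_difference_real (rho a b y t : R) :
  0 < rho -> 0 <= a -> 0 <= b -> 0 <= y -> 0 <= t -> a + b = 2 * (y + t) ->
  a / (rho + a) + b / (rho + b) - 2 * (y / (rho + y)) <= 2 * (t / (rho + t)).
Proof.
move=> rho0 a0 b0 y0 t0 ab.
have frac c : 0 <= c -> c / (rho + c) = 1 - rho / (rho + c).
  by move=> c0; field; apply: lt0r_neq0; lra.
have harmonic : 2 * (rho / (rho + y + t)) <= rho / (rho + a) + rho / (rho + b).
  have -> : rho + y + t = ((rho + a) + (rho + b)) / 2 by lra.
  rewrite -subr_ge0.
  have -> : rho / (rho + a) + rho / (rho + b) -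
      2 * (rho / (((rho + a) + (rho + b)) / 2))
     = rho * (a - b) ^+ 2 / ((rho + a) * (rho + b) * ((rho + a) + (rho + b))).
    by field; do ?[apply/andP; split]; apply: lt0r_neq0; lra.
  by apply: divr_ge0; [rewrite mulr_ge0 ?sqr_ge0// ltW|do 2 ?apply: mulr_ge0; lra].
have gap : rho / (rho + y) - rho / (rho + y + t) <= t / (rho + t).
  have -> : rho / (rho + y) - rho / (rho + y + t) =
      rho / (rho + y) * (t / (rho + y + t)).
    by field; do ?[apply/andP; split]; apply: lt0r_neq0; lra.
  rewrite -[leRHS]mul1r ler_pM ?divr_ge0//; try lra.
    by rewrite ler_pdivrMr; lra.
  by rewrite ler_wpM2l// lef_pV2 ?posrE; lra.
rewrite !frac// in harmonic gap *; lra.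
Qed.

Lemma barrier_second_difference r x0 x z : 0 < r ->
  barrier r x0 (x + z) + barrier r x0 (x - z) - 2 * barrier r x0 x
    <= 2 * (enorm z ^+ 2 / (r ^+ 2 + enorm z ^+ 2)).
Proof.
move=> r0; apply: second_difference_real; rewrite ?sqr_ge0 ?exprn_gt0//.
by rewrite (addrAC x) (addrAC x (- z)) enorm_parallelogram.
Qed.

(** The quotient is at most both 1 and [(q / r)^2], hence at most [(q / r)^s], as seen by separating
    [q <= r] from [q > r]. Where the minimum is [q^2], [r >= 1] gives [r^(-2) <= r^(-s)]. *)
Lemma barrier_gain (r s q : R) : 1 <= r -> 0 < q -> 0 < s <= 2 ->
  q ^+ 2 / (r ^+ 2 + q ^+ 2) <= r `^ (- s) * Num.min (q ^+ 2) (q `^ s).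
Proof.
move=> r1 q0 /andP[s0 s2]; have r0 : 0 < r by lra.
have r20 : 0 < r ^+ 2 by rewrite exprn_gt0.
have q20 : 0 < q ^+ 2 by rewrite exprn_gt0.
have hr : q ^+ 2 / (r ^+ 2 + q ^+ 2) <= q ^+ 2 / r ^+ 2.
  by rewrite ler_wpM2l ?(ltW q20)// lef_pV2 ?posrE; lra.
rewrite powRN; have [_|_] := leP (q ^+ 2) (q `^ s).
  apply: (le_trans hr); rewrite mulrC ler_wpM2r ?(ltW q20)//.
  rewrite lef_pV2 ?posrE ?powR_gt0// -powR_mulrn ?(ltW r0)//.
  exact: ler_powR.
have -> : (r `^ s)^-1 * q `^ s = (q / r) `^ s.
  rewrite powRM ?invr_ge0 ?(ltW q0) ?(ltW r0)// -(powR_inv1 (ltW r0)).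
  by rewrite -powRrM mulN1r powRN mulrC.
have [qr|rq] := leP q r.
  apply: (le_trans hr); rewrite -expr_div_n -powR_mulrn ?divr_ge0 ?(ltW q0) ?(ltW r0)//.
  by apply: ger_powR => //; rewrite divr_gt0//= ler_pdivrMr ?mul1r.
apply: (@le_trans _ _ 1); first by rewrite ler_pdivrMr; lra.
rewrite -[leLHS](powRr0 (q / r)); apply: ler_powR; last exact: ltW.
by rewrite ler_pdivlMr ?mul1r// ltW.
Qed.

Lemma measurable_barrier_shift r x0 x : 0 < r ->
  measurable_fun [set: 'rV[R]_d] (fun z => barrier r x0 (x + z)).
Proof.
move=> r0.
have mq : measurable_fun [set: 'rV[R]_d] (fun z => enorm (x + z - x0) ^+ 2).
  under eq_fun do rewrite sqr_enorm.
  apply: measurable_sum => i; apply: measurable_funX.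
  under eq_fun do rewrite !mxE.
  apply: measurable_funB => //; apply: measurable_funD => //.
  exact: measurable_row_coord.
apply: measurable_funM => //.
under eq_fun do rewrite -powR_inv1 ?addr_ge0 ?sqr_ge0//.
apply: (measurableT_comp (measurable_powR _)).
exact: measurable_funD.
Qed.

End barrier.

Lemma le_scale2 (R : realType) (k rho a b : R) :
  0 <= k -> 0 <= rho -> a <= b -> 2 * (k * rho) * a <= 2 * (k * rho * b).
Proof.
by move=> k0 rho0 ab; rewrite -mulrA ler_pM2l// ler_wpM2l// mulr_ge0.
Qed.

(** * Estimates of the truncated operators *)

Section truncated_operator.
Variables (R : realType) (d : nat) (alpha kappa1 : R).
Variable kappa : 'rV[R]_d -> 'rV[R]_d -> R.
Hypothesis alpha02 : 0 < alpha < 2.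
Hypothesis mkappa : forall x, measurable_fun setT (kappa x).
Hypothesis kappa_bounds : forall x z, 0 <= kappa x z <= kappa1.
Hypothesis kappa_sym : forall x z, kappa x z = kappa x (- z).
Variable eps : R.
Hypothesis eps01 : 0 < eps < 1.

Local Notation mu := (@lebesgue_row R d).
Local Notation D := [set z : 'rV[R]_d | eps < enorm z].
Local Notation G :=
  (\int[mu]_(z in [set z : 'rV[R]_d | 0 < enorm z]) levy_weight alpha z).
Local Notation kernel := (fun x z => kappa x z / enorm z `^ (d%:R + alpha)).

Let mD : measurable D := @measurable_enorm_gt R d eps.
Let mD0 : measurable [set z : 'rV[R]_d | 0 < enorm z] := @measurable_enorm_gt R d 0.

Let DD0 : D `<=` [set z : 'rV[R]_d | 0 < enorm z].
Proof. by move=> z /= ez; case/andP: eps01 => e0 _; exact: lt_trans ez. Qed.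

Lemma integrable_levy_weight :
  mu.-integrable [set z : 'rV[R]_d | 0 < enorm z] (EFin \o levy_weight alpha).
Proof.
apply/integrableP; split.
  by apply/measurable_EFinP; apply: measurable_funTS; exact: measurable_levy_weight.
under eq_integral do rewrite /= ger0_norm ?levy_weight_ge0//.
exact: levy_weight_integral_lty.
Qed.

Let int_weight : mu.-integrable D (EFin \o levy_weight alpha).
Proof. exact: (integrableS mD0 mD DD0 integrable_levy_weight). Qed.

Let int_weightZ c : mu.-integrable D (EFin \o (fun z => c * levy_weight alpha z)).
Proof. exact: (integrable_EFinZl c mD int_weight). Qed.

Lemma kernel_ge0 x z : 0 <= kernel x z.
Proof. by have /andP[k0 _] := kappa_bounds x z; rewrite divr_ge0 ?powR_ge0. Qed.

(** For [|z| > eps] both entries of the minimum in the weight are at least [eps^2], the second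
    because [eps < 1] and [alpha / 2 <= 2]. This provides an integrable majorant for each fixed
    [eps]. *)
Lemma kernel_le_weight x z :
  D z -> kernel x z <= kappa1 / eps ^+ 2 * levy_weight alpha z.
Proof.
move=> /= ez; have /andP[e0 e1] := eps01; have /andP[a0 a2] := alpha02.
have /andP[k0 k1] := kappa_bounds x z.
have z0 : 0 < enorm z by exact: lt_trans ez.
rewrite /levy_weight mulrA ler_wpM2r ?invr_ge0 ?powR_ge0//.
apply: (le_trans k1); rewrite -mulrA ler_peMr ?(le_trans k0)//.
rewrite mulrC ler_pdivlMr ?exprn_gt0// mul1r le_min.
apply/andP; split; first by rewrite ler_pXn2r ?nnegrE ?ltW.
apply: (@le_trans _ _ (eps `^ (alpha / 2))).
  rewrite -powR_mulrn ?(ltW e0)//; apply: ger_powR; first by rewrite e0 ltW.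
  by rewrite ler_pdivrMr//; lra.
by apply: ge0_ler_powR; rewrite ?nnegrE ?divr_ge0 ?ltW.
Qed.

Lemma measurable_kernel x : measurable_fun setT (kernel x).
Proof. by apply: measurable_funM => //; exact: measurable_inv_enorm_powR. Qed.

Variables (r : R) (x0 x : 'rV[R]_d).
Hypothesis r1 : 1 <= r.
Let r0 : 0 < r. Proof. exact: lt_le_trans r1. Qed.

Local Notation phi := (barrier r x0).
Let H z := (phi (x + z) - phi x) * kernel x z.

Let mH : measurable_fun setT H.
Proof.
apply: measurable_funM; last exact: measurable_kernel.
by apply: measurable_funB => //; exact: measurable_barrier_shift.
Qed.

Let H_le z : D z -> `|H z| <= kappa1 / eps ^+ 2 * levy_weight alpha z.
Proof.
move=> Dz; apply: le_trans (kernel_le_weight x Dz).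
rewrite normrM (ger0_norm (kernel_ge0 x z)) -[leRHS]mul1r.
rewrite ler_wpM2r ?kernel_ge0// ler_norml.
have := barrier_ge0 r x0 x; have := barrier_ge0 r x0 (x + z).
have := @barrier_le1 R d r x0 x r0; have := @barrier_le1 R d r x0 (x + z) r0.
by move=> *; apply/andP; split; lra.
Qed.

Let intH : mu.-integrable D (EFin \o H).
Proof.
apply: (le_integrable mD _ _ (int_weightZ (kappa1 / eps ^+ 2))).
  by apply/measurable_EFinP; apply: measurable_funTS; exact: mH.
move=> z Dz /=; rewrite lee_fin (le_trans (H_le Dz))// ler_norm//.
Qed.

Let symD : -%R @^-1` D = D.
Proof. by apply/seteqP; split => z /=; rewrite enormN. Qed.

Let intHN : mu.-integrable D (EFin \o (H \o -%R)).
Proof.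
apply: (le_integrable mD _ _ (int_weightZ (kappa1 / eps ^+ 2))).
  apply/measurable_EFinP; apply: measurable_funTS; apply: (measurableT_comp mH).
  exact: measurable_row_opp.
move=> z Dz /=; rewrite lee_fin.
have DNz : D (- z) by rewrite /= enormN.
by rewrite (le_trans (H_le DNz))// /levy_weight enormN ler_norm.
Qed.

Let weighted_le (S k w m rho : R) : 0 <= k <= kappa1 -> 0 <= w -> 0 <= m ->
  0 <= rho -> S <= 2 * (rho * m) -> S * (k * w) <= 2 * (kappa1 * rho) * (m * w).
Proof.
move=> /andP[k0 k1] w0 m0 rho0 Sm.
apply: (@le_trans _ _ (2 * (rho * m) * (k * w))); first by rewrite ler_wpM2r ?mulr_ge0.
rewrite (_ : 2 * (kappa1 * rho) * (m * w) = 2 * (rho * m) * (kappa1 * w)); last by ring.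
by rewrite ler_wpM2l ?mulr_ge0// ler_wpM2r.
Qed.

(** Evenness of [kappa] gives [z] and [-z] the same kernel, so the two integrands add up to a second
    difference of the barrier. *)
Let H_second_difference z : 0 < enorm z ->
  H z + (H \o -%R) z <= 2 * (kappa1 * r `^ (- (alpha / 2))) * levy_weight alpha z.
Proof.
move=> z0; have /andP[a0 a2] := alpha02.
have -> : H z + (H \o -%R) z =
    (phi (x + z) + phi (x - z) - 2 * phi x) * kernel x z.
  by rewrite /H /= enormN -kappa_sym -mulrDl; congr (_ * _); ring.
apply: weighted_le; rewrite ?invr_ge0 ?powR_ge0// ?le_min ?sqr_ge0 ?powR_ge0//.
apply: (le_trans (barrier_second_difference x0 x z r0)).
by rewrite ler_pM2l//; apply: barrier_gain => //; apply/andP; split; lra.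
Qed.

(** Adding the integral to its reflection turns first differences into second differences. Their
    majorant is integrable over all of [0 < |z|], so the bound depends on neither [eps] nor the
    points [x0] and [x]. *)
Lemma truncated_nonlocal_op_barrier :
  truncated_nonlocal_op kappa alpha phi x eps <= kappa1 * r `^ (- (alpha / 2)) * G.
Proof.
have /andP[a0 a2] := alpha02.
have k0 : 0 <= kappa1 by have /andP[/le_trans] := kappa_bounds 0 0; apply.
rewrite -[_ <= _]/(\int[mu]_(z in D) H z <= _).
have HN : \int[mu]_(z in D) (H \o -%R) z = \int[mu]_(z in D) H z.
  exact: (Rintegral_rowN mD symD mH intHN).
suff : \int[mu]_(z in D) H z + \int[mu]_(z in D) (H \o -%R) z <=
    2 * (kappa1 * r `^ (- (alpha / 2)) * G).
  move=> h; rewrite -(ler_pM2l (ltr0Sn R 1)) [leLHS]mulr_natl mulr2n.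
  by rewrite -[X in _ + X <= _]HN.
rewrite -(RintegralD mD intH intHN).
pose c := 2 * (kappa1 * r `^ (- (alpha / 2))).
apply: (@le_trans _ _ (\int[mu]_(z in D) (c * levy_weight alpha z))).
  apply: (le_Rintegral mD (integrable_EFinD mD intH intHN) (int_weightZ c)).
  by move=> z Dz; exact: H_second_difference (DD0 Dz).
rewrite (RintegralZl c mD int_weight).
have : \int[mu]_(z in D) levy_weight alpha z <= G.
  apply: fine_le.
  - exact: (integrable_fin_num mD int_weight).
  - exact: (integrable_fin_num mD0 integrable_levy_weight).
  apply: (ge0_subset_integral mu mD mD0 _ _ DD0).
  - by apply/measurable_EFinP; apply: measurable_funTS; exact: measurable_levy_weight.
  - by move=> z _; rewrite lee_fin levy_weight_ge0.
by move=> /(le_scale2 k0 (powR_ge0 _ _)); apply.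
Qed.

(** The second hypothesis says that [f - K phi] is maximal at [x]; the nonnegative kernel carries
    this over to the integrals. The bound [M] supplies the majorant [2 M] times that of the
    kernel. *)
Lemma truncated_nonlocal_op_le_barrier (f : 'rV[R]_d -> R) (M K : R) :
  (forall y, `|f y| <= M) ->
  (forall y, f y - f x <= K * (phi y - phi x)) ->
  truncated_nonlocal_op kappa alpha f x eps <=
    K * truncated_nonlocal_op kappa alpha phi x eps.
Proof.
move=> fM fK; rewrite /truncated_nonlocal_op -(RintegralZl K mD intH).
apply: (le_Rintegral_dominated mD (integrable_EFinZl K mD intH)
  (int_weightZ (2 * M * (kappa1 / eps ^+ 2)))).
- move=> z Dz; rewrite normrM (ger0_norm (kernel_ge0 x z)) -(mulrA (2 * M)).
  apply: ler_pM; rewrite ?kernel_ge0//; last exact: kernel_le_weight.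
  by rewrite (le_trans (ler_normB _ _))// mulr2n mulrDl mul1r lerD.
- move=> z Dz; rewrite /H [leRHS]mulrA; apply: ler_wpM2r; [exact: kernel_ge0|exact: fK].
Qed.

End truncated_operator.

(** * Time derivative at a maximum, continuity and compactness *)

(** The maximum may sit at the final time, so only left difference quotients are available. Dividing
    the maximality inequality by [h < 0] reverses it and bounds each quotient below by [delta]. *)
Lemma derive_ge_left_max (R : realType) (f : R -> R) (t L delta : R) :
  0 < t -> is_derive t 1 f L ->
  (forall s, 0 <= s <= t -> f s - delta * s <= f t - delta * t) -> delta <= L.
Proof.
move=> t0 [dfL <-] fmax; rewrite /derive cvg_at_leftE//.
apply: limr_ge.
  apply/cvg_ex.
  exists (lim (h^-1 *: ((f \o shift t) (h *: 1) - f t) @[h --> (0:R)^'])).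
  exact: cvg_dnbhs_at_left.
near=> h.
have h0 : h < 0 by near: h; exact: nbhs_left_lt.
have ht : - t < h by near: h; apply: nbhs_left_gt; rewrite oppr_lt0.
rewrite /= -[_ *: 1]/(h * 1) mulr1 -[_ *: _]/(h^-1 * _).
rewrite mulrC ler_ndivlMr//.
have /fmax : 0 <= h + t <= t by apply/andP; split; lra.
rewrite /shift/=; lra.
Unshelve. all: by end_near. Qed.

Lemma continuous_sum_sqr (T : topologicalType) (R : realType) (I : Type)
    (s : seq I) (f : I -> T -> R) :
  (forall i, continuous (f i)) -> continuous (fun x => \sum_(i <- s) f i x ^+ 2).
Proof.
move=> cf; elim: s => [|i s IH].
  rewrite (_ : (fun x => _) = cst 0); first exact: cst_continuous.
  by apply/funext => x; rewrite big_nil.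
rewrite (_ : (fun x => _) = (fun x =>
    f i x * f i x + \sum_(j <- s) f j x ^+ 2)); last first.
  by apply/funext => x; rewrite big_cons expr2.
by move=> x; apply: cvgD; [apply: cvgM; exact: cf|exact: IH].
Qed.

Lemma continuous_saturation (T : topologicalType) (R : realType) (c : R) (q : T -> R) :
  0 < c -> (forall x, 0 <= q x) -> continuous q ->
  continuous (fun x => q x / (c + q x)).
Proof.
move=> c0 q0 cq x; apply: cvgM; first exact: cq.
apply: cvgV; last by apply: cvgD; [exact: cvg_cst|exact: cq].
by rewrite gt_eqF// ltr_pwDl.
Qed.

Lemma continuous_barrier (R : realType) d (r : R) (x0 : 'rV[R]_d) :
  0 < r -> continuous (barrier r x0).
Proof.
move=> r0; apply: (@continuous_saturation 'rV[R]_d R (r ^+ 2)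
  (fun x => enorm (x - x0) ^+ 2)); [by rewrite exprn_gt0|by move=> x; rewrite sqr_ge0|].
rewrite (_ : (fun x => _) = (fun x : 'rV[R]_d =>
    \sum_(i < d) (x ord0 i - x0 ord0 i) ^+ 2)); last first.
  by apply/funext => x; rewrite sqr_enorm; apply: eq_bigr => i _; rewrite !mxE.
apply: (@continuous_sum_sqr 'rV[R]_d R _ _ (fun i x => x ord0 i - x0 ord0 i)) => i x.
by apply: continuousB; [exact: coord_continuous|exact: cst_continuous].
Qed.

Lemma compact_sup_cube (R : realType) d (r : R) (x0 : 'rV[R]_d) :
  compact [set x : 'rV[R]_d | forall i,
    `[x0 ord0 i - r, x0 ord0 i + r]%classic (x ord0 i)].
Proof.
apply: (@rV_compact R d (fun i => `[x0 ord0 i - r, x0 ord0 i + r]%classic)) => i.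
exact: segment_compact.
Qed.

Lemma sup_ge_elt (R : realType) (T : Type) (f : T -> R) (M : R) x :
  (forall y, f y <= M) -> f x <= sup [set f y | y in [set: T]].
Proof.
move=> fM; apply: ub_le_sup; last by exists x.
by exists M => _ [y _ <-].
Qed.

Lemma exists_scale (R : realType) (c delta s : R) : 0 <= c -> 0 < delta -> 0 < s ->
  exists2 r, 1 <= r & c * r `^ (- s) < delta.
Proof.
(* With [r = A^(1/s)] one has [r^(-s) = 1 / A], and [c < delta * A = c + delta]; the added 1 also
   ensures [r >= 1]. *)
move=> c0 d0 s0; pose A := c / delta + 1.
have cd0 : 0 <= c / delta by rewrite divr_ge0// ltW.
have A1 : 1 <= A by rewrite lerDr.
have A0 : 0 < A by exact: lt_le_trans A1.
exists (A `^ s^-1).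
  by rewrite -[leLHS](powRr0 A); apply: ler_powR => //; rewrite invr_ge0 ltW.
rewrite -powRrM mulrN mulVf ?gt_eqF// powR_inv1 ?(ltW A0)//.
by rewrite ltr_pdivrMr// /A mulrDr mulr1 mulrCA mulfV ?gt_eqF// mulr1 ltrDl.
Qed.

(** * Existence of a maximum for the penalised function *)

Section maximum.
Variables (R : realType) (d : nat) (u : R -> 'rV[R]_d -> R).
Hypothesis cu : {within `[(0 : R), 1] `*` [set: 'rV[R]_d],
  continuous (fun p : R * 'rV[R]_d => u p.1 p.2)}.
Variable M : R.
Hypothesis uM : forall t x, 0 <= t <= 1 -> `|u t x| <= M.
Variables (t0 delta r : R) (x0 : 'rV[R]_d).
Hypotheses (t01 : 0 < t0 < 1) (delta0 : 0 < delta) (r0 : 0 < r).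
(** At distance at least [r] from [x0] the penalty is at least [K / 2], which exceeds the
    oscillation [2 M] of [u] plus the drift [delta * t0 <= delta]. *)
Local Notation K := (2 * (2 * M + delta + 1)).
Let w (p : R * 'rV[R]_d) := u p.1 p.2 - delta * p.1 - K * barrier r x0 p.2.

Let M0 : 0 <= M.
Proof. by apply: le_trans (uM (t := 0) x0 _); rewrite ?normr_ge0// lexx ler01. Qed.

Let far_low t x : 0 <= t <= t0 -> r <= enorm (x - x0) -> w (t, x) <= w (t0, x0).
Proof.
move=> /andP[tge tle] rx; have /andP[t00 t01'] := t01.
rewrite /w /= barrier_center mulr0 subr0.
have b2 := barrier_far r0 rx.
have /(uM x) : 0 <= t <= 1 by apply/andP; split; lra.
have /(uM x0) : 0 <= t0 <= 1 by apply/andP; split; lra.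
rewrite !ler_norml => /andP[h1 _] /andP[_ h2].
have : K * 2^-1 <= K * barrier r x0 x.
  by rewrite ler_wpM2l//; move: M0 delta0; lra.
have dt : 0 <= delta * t by rewrite mulr_ge0// ltW.
have dt0 : delta * t0 <= delta by rewrite ler_piMr// ltW.
lra.
Qed.

(** A maximum exists on the compact product of [[0, t0]] and the sup-norm cube about [x0]. Points
    outside the cube are at Euclidean distance at least [r], so [far_low] puts them below the value
    at [(t0, x0)], which lies in the product. *)
Lemma perturbation_max : exists ts xs, 0 <= ts <= t0 /\
  forall t x, 0 <= t <= t0 -> w (t, x) <= w (ts, xs).
Proof.
have /andP[t00 t01'] := t01.
pose B := [set x : 'rV[R]_d | forall i,
  `[x0 ord0 i - r, x0 ord0 i + r]%classic (x ord0 i)].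
pose S : set (R * 'rV[R]_d) := `[0, t0]%classic `*` B.
have Sx0 : S (t0, x0).
  split => /=; first by rewrite in_itv/= lexx ltW.
  by move=> i; rewrite /= ?in_itv/=; apply/andP; split; move: r0; lra.
have cS : compact S.
  by apply: compact_setX; [exact: segment_compact|exact: compact_sup_cube].
have cw : {within S, continuous w}.
  have SS : S `<=` `[(0 : R), 1] `*` [set: 'rV[R]_d].
    move=> [t x] [/=]; rewrite !in_itv/= => /andP[? ?] _; split => //=.
    by rewrite ?in_itv/=; apply/andP; split; lra.
  have cu' := continuous_subspaceW SS cu.
  have cphi : {within S, continuous (fun p : R * 'rV[R]_d =>
      delta * p.1 + K * barrier r x0 p.2)}.
    apply: continuous_subspaceT => p; apply: cvgD.
      by apply: cvgM; [exact: cvg_cst|exact: cvg_fst].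
    apply: cvgM; first exact: cvg_cst.
    apply: (@cvg_comp _ _ _ (fun q : R * 'rV[R]_d => q.2) (barrier r x0)).
      exact: cvg_snd.
    exact: continuous_barrier.
  rewrite (_ : w = (fun p =>
      u p.1 p.2 - (delta * p.1 + K * barrier r x0 p.2))); last first.
    by apply/funext => p; rewrite /w opprD addrA.
  by move=> p; apply: cvgB; [exact: cu'|exact: cphi].
have [[ts xs] + wmax] := compact_EVT_max (ex_intro _ _ Sx0) cS cw.
rewrite inE => -[/= ts0 _]; exists ts, xs; split; first by move: ts0; rewrite in_itv.
move=> t x tt.
have [Bx|nBx] := pselect (B x).
  by apply: wmax; rewrite inE; split => //=; rewrite in_itv.
apply: (@le_trans _ _ (w (t0, x0))); last by apply: wmax; rewrite inE.
apply: far_low => //.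
rewrite leNgt; apply/negP => xr; apply: nBx => i /=.
have := le_lt_trans (coord_le_enorm (x - x0) i) xr.
by rewrite !mxE ltr_norml in_itv/= => /andP[? ?]; apply/andP; split; lra.
Qed.

End maximum.

(** * Contradiction at the maximum of the penalised function *)

Theorem theorem4p1 (R : realType) (d : nat) (hd : (1 <= d)%N)
  (alpha beta : R) (halpha : 0 < alpha < 2) (hbeta : 0 < beta < 1)
  (kappa : 'rV[R]_d -> 'rV[R]_d -> R) (kappa0 kappa1 kappa2 : R)
  (hkappa_meas : measurable_fun [set: 'rV[R]_d * 'rV[R]_d]
     (fun p : 'rV[R]_d * 'rV[R]_d => kappa p.1 p.2))
  (hkappa0 : 0 < kappa0)
  (hkappa_bounds : forall x z : 'rV[R]_d, kappa0 <= kappa x z <= kappa1)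
  (hkappa_sym : forall x z : 'rV[R]_d, kappa x z = kappa x (- z))
  (hkappa_holder : forall x y z : 'rV[R]_d,
     `|kappa x z - kappa y z| <= kappa2 * enorm (x - y) `^ beta)
  (u : R -> 'rV[R]_d -> R)
  (hu_Cb : bounded_continuous_on (`[(0 : R), 1] `*` [set: 'rV[R]_d])
     (fun p : R * 'rV[R]_d => u p.1 p.2))
  (hu_init :
     sup [set `|u t x - u 0 x| | x in [set: 'rV[R]_d]] @[t --> 0^'+] --> (0 : R))
  (hLu_exists : forall (t : R) (x : 'rV[R]_d), 0 < t <= 1 ->
     nonlocal_op_exists kappa alpha (u t) x)
  (hLu_cont : forall x : 'rV[R]_d,
     {within `]0, 1], continuous (fun t : R => nonlocal_op kappa alpha (u t) x)})
  (gamma : R) (hgamma : Num.max (alpha - 1) 0 < gamma < 1)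
  (hu_holder : forall eps : R, 0 < eps < 1 ->
     exists C : R, forall x x' : 'rV[R]_d,
       sup [set `|u t x - u t x'| | t in `]eps, 1[] <= C * enorm (x - x') `^ gamma)
  (hu_eq : forall (t : R) (x : 'rV[R]_d), 0 < t < 1 ->
     is_derive t 1 (fun s : R => u s x) (nonlocal_op kappa alpha (u t) x)) :
  forall t : R, 0 < t < 1 ->
    sup [set u t x | x in [set: 'rV[R]_d]]
      <= sup [set u 0 x | x in [set: 'rV[R]_d]].
Proof.
move=> t0 ht0; have /andP[t00 t01] := ht0; have /andP[a0 a2] := halpha.
have [cu [M' [_ /(_ (Num.max M' 0 + 1))]]] := hu_Cb.
(* Boundedness is available for every number strictly above [M'], whence the added 1. *)
set M := Num.max M' 0 + 1 => uM'.
have uM t x : 0 <= t <= 1 -> `|u t x| <= M.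
  move=> t01'; apply: (uM' _ (t, x)); last by split => //=; rewrite in_itv.
  by rewrite /M (@le_lt_trans _ _ (Num.max M' 0)) ?le_max ?lexx// ltrDl.
have u_leM t x : 0 <= t <= 1 -> u t x <= M.
  by move=> /(uM _ x); rewrite ler_norml => /andP[].
apply: ge_sup; first by exists (u t0 0), 0.
move=> _ [x0 _ <-]; rewrite leNgt; apply/negP.
set m := sup _ => m_lt.
have um x : u 0 x <= m by apply: (@sup_ge_elt _ _ _ M) => y; rewrite u_leM ?lexx ?ler01.
(* Half of the excess: the drift up to time [t0 < 1] then costs at most [delta] and leaves
   [w (t0, x0) >= m + delta]. *)
pose delta := (u t0 x0 - m) / 2.
have delta0 : 0 < delta by rewrite divr_gt0// subr_gt0.
pose K := 2 * (2 * M + delta + 1).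
have M0 : 0 <= M by apply: le_trans (uM 0 0 _); rewrite ?lexx ?ler01.
have K0 : 0 <= K by rewrite /K; lra.
have kb x z : 0 <= kappa x z <= kappa1.
  by have /andP[k0 ->] := hkappa_bounds x z; rewrite andbT (le_trans _ k0)// ltW.
have k10 : 0 <= kappa1 by have /andP[/le_trans] := kb 0 0; apply.
have mk x : measurable_fun setT (kappa x).
  exact: (measurableT_comp hkappa_meas (pair1_measurable x)).
pose G := \int[@lebesgue_row R d]_(z in [set z : 'rV[R]_d | 0 < enorm z])
  levy_weight alpha z.
have G0 : 0 <= G by apply: Rintegral_ge0 => z _; exact: levy_weight_ge0.
(* The scale can be chosen last because [K], [G] and [delta] do not involve it. *)
have [r r1 hr] : exists2 r, 1 <= r & K * (kappa1 * G) * r `^ (- (alpha / 2)) < delta.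
  exact: (exists_scale (mulr_ge0 K0 (mulr_ge0 k10 G0)) delta0
    (divr_gt0 a0 (ltr0Sn R 1))).
have r0 : 0 < r by exact: lt_le_trans r1.
have [ts [xs [/andP[ts0 tst0] wmax]]] := perturbation_max cu uM x0 ht0 delta0 r0.
rewrite /= -/K in wmax.
(* At time 0 the penalised function is at most [m], whereas its value at [(t0, x0)] is at least
   [m + delta]. *)
have ts_gt0 : 0 < ts.
  rewrite lt_neqAle ts0 andbT; apply/eqP => tsE; have := wmax t0 x0.
  rewrite -tsE barrier_center !mulr0 !subr0 lexx (ltW t00) => /(_ isT).
  have : 0 <= K * barrier r x0 xs by rewrite mulr_ge0// barrier_ge0.
  have : delta * t0 <= delta by rewrite ler_piMr// ltW.
  have : u t0 x0 = m + 2 * delta by rewrite /delta; field.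
  have := um xs; move: (K * _) => b; lra.
have ts01 : 0 < ts < 1 by rewrite ts_gt0 (le_lt_trans tst0).
have ts_le1 : 0 < ts <= 1 by rewrite ts_gt0 ltW//; case/andP: ts01.
have uMs y : `|u ts y| <= M by apply: uM; rewrite ts0; case/andP: ts_le1.
have du : delta <= nonlocal_op kappa alpha (u ts) xs.
  apply: (derive_ge_left_max ts_gt0 (hu_eq ts xs ts01)) => s /andP[s0 sts].
  have := wmax s xs; rewrite s0 (le_trans sts tst0) => /(_ isT).
  by rewrite lerD2r.
have : nonlocal_op kappa alpha (u ts) xs <= K * (kappa1 * G) * r `^ (- (alpha / 2)).
  (* The principal value exists, so a bound on the truncated operators uniform in small [eps] passes
     to the limit. *)
  apply: limr_le; first exact: hLu_exists.
  near=> eps.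
  have eps01 : 0 < eps < 1.
    by apply/andP; split; near: eps; [exact: nbhs_right_gt|exact: nbhs_right_lt].
  apply: (le_trans (truncated_nonlocal_op_le_barrier halpha mk kb eps01 r1 uMs
    (K := K) (x0 := x0) _)).
    move=> y; have := wmax ts y; rewrite ts0 tst0 => /(_ isT).
    by rewrite mulrBr; lra.
  rewrite -mulrA ler_wpM2l//.
  apply: (le_trans (truncated_nonlocal_op_barrier halpha mk kb hkappa_sym eps01
    x0 xs r1)).
  by rewrite mulrAC.
by move=> /(le_trans du) /le_lt_trans /(_ hr); rewrite ltxx.
Unshelve. all: by end_near. Qed.
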